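(* Let $p>1$ and $q=p/(p-1)$. Let $a_m\ge 0$, $b_m\ge 0$, $c_m\ge 0$, $d_m\ge 0$ for $m=0,1,2,\dots$ be real numbers such that each of the four sums $\sum_{m=1}^{\infty}a_m^p$, $\sum_{m=1}^{\infty}b_m^q$, $\sum_{m=0}^{\infty}c_m^p$, $\sum_{m=0}^{\infty}d_m^q$ is strictly positive and finite. Then $$c_0d_0+\sum_{m=1}^{\infty}\sum_{n=1}^{\infty}\left(\frac{a_mb_n}{m+n}+\frac{c_md_n}{m+n+1}\right)\le \frac{\pi}{\sin(\pi/p)}\left(c_0^p+\sum_{m=1}^{\infty}\left(a_m^p+c_m^p\right)\right)^{1/p}\left(d_0^q+\sum_{m=1}^{\infty}\left(b_m^q+d_m^q\right)\right)^{1/q}.$$ *)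

From mathcomp Require Import all_boot all_order all_algebra.
From mathcomp Require Import all_classical all_reals all_analysis.
From mathcomp Require Import ring lra.
Import Order.TTheory GRing.Theory Num.Theory.
Import numFieldNormedType.Exports.
Local Open Scope ring_scope.

(** Both double series are instances of the Hilbert form
    sum_(m, n >= 0) x_m y_n / (m + n + 1): for [c], [d] directly, the terms with
    exactly one zero index being dropped, and for [a], [b] after shifting both
    indices by one, since 1 / (m + n + 2) <= 1 / (m + n + 1).  Everything is
    therefore an inequality between finite sums, followed by a supremum.

    The finite inequality is a Schur test with exact weights.  Put s = 1/q and
    w_s(m) = s (s + 1) ... (s + m - 1) / m!.  By Young's inequality,
    x_m y_n is at most
    x_m^p w_s(m)^(-p/q) w_(1-s)(n) / p + y_n^q w_(1-s)(n)^(-q/p) w_s(m) / q.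
    The weights are Taylor coefficients of (1 - t)^(-s) and (1 - t)^(s-1), so
    that the row sums are beta integrals with a closed form: the sum over n of
    w_(1-s)(n) / (m + n + 1) is 1 / (w_s(m) (s + m)).  Partial sums are bounded
    by this value through a telescoping identity ([ratio_weight_row_sum]).
    What remains is a factor X_s(m)^p on x_m^p and X_(1-s)(n)^q on y_n^q, where
    X_s(m) = 1 / (w_s(m) (s + m)^(1-s)) ([hilbert_multiplier]).  The weighted
    AM-GM inequality makes X_s increasing, so on a block of size N it is at most
    X_s(N); rescaling x and y by these two constants before applying Young's
    inequality makes the constant of the block X_s(N) X_(1-s)(N).

    That product is at most pi / sin (pi s) ([hilbert_multiplier_mul]), because
    w_s(m) w_(1-s)(m) (s + m) is the partial Euler product
    s prod_(j <= m) (1 - s^2 / j^2), which is at least sin (pi s) / pi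
    ([sin_le_Euler_prod]).  The last fact comes from the recursion by parts for
    the integrals of cos^(2k) x cos (2 s x) over [0, pi/2], compared with the
    same recursion at s = 0.

    The form with A/p + B/q on the right is additive, so it is applied to the
    pairs ([a], [b]) and ([c], [d]) together, and one rescaling by A^(1/p) and
    B^(1/q) turns it into the product form ([hilbert_pair]). *)

(** * Partial Euler products for the sine *)

(** The values at pi/2 of these antiderivatives are the integrals I_k of
    cos^(2k) x cos (2 s x) over [0, pi/2], and the product identity is the
    iterated recursion 4 (n^2 - s^2) I_n = 2 n (2 n - 1) I_(n-1).  Building the
    antiderivatives along the recursion replaces integration by
    differentiation.  The base function [P] is a parameter so that s = 0, where
    P x = x, is included beside P x = sin (2 s x) / (2 s). *)
Lemma cos_pow_antiderivative {R : realType} (s : R) (P : R -> R) (k : nat) :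
  0 <= s < 1 ->
  (forall x : R, is_derive x 1 P (cos (2 * s * x))) -> P 0 = 0 ->
  exists F : R -> R,
    [/\ forall x : R, is_derive x 1 F (cos x ^+ (2 * k) * cos (2 * s * x)),
        F 0 = 0
      & F (pi / 2) * \prod_(j < k) (1 - s ^+ 2 / j.+1%:R ^+ 2)
        = P (pi / 2) * \prod_(j < k) ((2 * j).+1%:R / (2 * j).+2%:R)].
Proof.
move=> /andP[s0 s1] dP P0.
have dM (f g : R -> R) (x df dg : R) :
    is_derive x 1 f df -> is_derive x 1 g dg ->
    is_derive x 1 (fun y => f y * g y) (df * g x + f x * dg).
  move=> Hf Hg; apply: (is_derive_eq (is_deriveM Hf Hg)).
  by rewrite /GRing.scale /=; ring.
have dZ (c : R) (f : R -> R) (x df : R) :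
    is_derive x 1 f df -> is_derive x 1 (fun y => c * f y) (c * df).
  by move=> Hf; exact: (is_deriveZ c Hf).
have dB (f g : R -> R) (x df dg : R) :
    is_derive x 1 f df -> is_derive x 1 g dg ->
    is_derive x 1 (fun y => f y - g y) (df - dg).
  by move=> Hf Hg; exact: (is_deriveB Hf Hg).
have dlin (x : R) : is_derive x 1 (fun y : R => 2 * s * y) (2 * s).
  by rewrite -[X in is_derive _ _ _ X]mulr1; apply: dZ; exact: is_derive_id.
have dsin (x : R) :
    is_derive x 1 (fun y : R => sin (2 * s * y)) (2 * s * cos (2 * s * x)).
  apply: (is_derive_eq (is_derive1_comp (is_derive_sin _) (dlin x))).
  by rewrite mulrC.
have dcos (x : R) :
    is_derive x 1 (fun y : R => cos (2 * s * y)) (- (2 * s * sin (2 * s * x))).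
  apply: (is_derive_eq (is_derive1_comp (is_derive_cos _) (dlin x))).
  by ring.
have dcosX (x : R) m : is_derive x 1 (fun y : R => cos y ^+ m)
    (- (m%:R * cos x ^+ m.-1 * sin x)).
  have -> : (fun y : R => cos y ^+ m) = cos ^+ m.
    by apply/funext => y; rewrite fctE.
  apply: (is_derive_eq (is_deriveX m (is_derive_cos x))).
  by rewrite /GRing.scale /=; ring.
elim: k => [|k [F [dF F0 Fpi]]].
  exists P; rewrite !big_ord0; split => // x.
  by rewrite expr0 mul1r; exact: dP.
pose n : R := k.+1%:R.
have n1 : 1 <= n by rewrite /n ler1n.
have ns : n ^+ 2 - s ^+ 2 != 0 by apply: lt0r_neq0; nra.
(* Boundary term of two integrations by parts; it vanishes at 0 and pi/2. *)
pose G (x : R) := s * (cos x ^+ (2 * k).+2 * sin (2 * s * x))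
  - n * (cos x ^+ (2 * k).+1 * (sin x * cos (2 * s * x))).
have dG (x : R) : is_derive x 1 G
    (2 * (s ^+ 2 - n ^+ 2) * (cos x ^+ (2 * k.+1) * cos (2 * s * x))
     + n * (2 * k).+1%:R * (cos x ^+ (2 * k) * cos (2 * s * x))).
  apply: (is_derive_eq (dB _ _ _ _ _
    (dZ s _ _ _ (dM _ _ _ _ _ (dcosX x _) (dsin x)))
    (dZ n _ _ _ (dM _ _ _ _ _ (dcosX x _)
       (dM _ _ _ _ _ (is_derive_sin x) (dcos x)))))).
  rewrite mulnS /=.
  rewrite -[(2 * k).+2]/(2 + 2 * k)%N -[(2 * k).+1]/(1 + 2 * k)%N.
  have -> : (2 + 2 * k)%:R = 2 * n :> R by rewrite /n -natrM mulnS.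
  have -> : (1 + 2 * k)%:R = 2 * n - 1 :> R.
    by rewrite /n -natrM mulnS -[(2 + _)%N]/(1 + (1 + 2 * k))%N natrD; ring.
  rewrite !(exprD _ 2 (2 * k)) !(exprD _ 1 (2 * k)) expr1.
  set C := cos x; set S := sin x.
  have S2 : S ^+ 2 = 1 - C ^+ 2 by rewrite -(cos2Dsin2 x) /C /S; ring.
  set W := C ^+ (2 * k).
  set D := cos (2 * s * x); set T := sin (2 * s * x).
  move: S2; clearbody C S W D T n => S2; apply: subr0_eq.
  transitivity (n * (2 * n - 1) * W * D * (S ^+ 2 - (1 - C ^+ 2))).
    by ring.
  by rewrite S2 subrr mulr0.
exists (fun x => (2 * (n ^+ 2 - s ^+ 2))^-1 * (n * (2 * k).+1%:R * F x - G x)).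
split.
- move=> x; apply: (is_derive_eq (dZ _ _ _ _ (dB _ _ _ _ _
    (dZ (n * (2 * k).+1%:R) _ _ _ (dF x)) (dG x)))).
  set X := cos x ^+ (2 * k.+1) * _; set Y := cos x ^+ (2 * k) * _.
  move: ns; clearbody X Y n => ns; field.
  by rewrite ns.
- by rewrite /G /= F0 !mulr0 sin0 !(mul0r, mulr0) !subrr mulr0.
- rewrite {1}/G cos_pihalf !expr0n /= !(mul0r, mulr0) subr0.
  rewrite !big_ord_recr /= -/n.
  have -> : (2 * k).+2%:R = 2 * n :> R by rewrite /n -natrM mulnS.
  have n0 : n != 0 by apply: lt0r_neq0; lra.
  rewrite [RHS]mulrA -Fpi.
  set f := F _; set E := \prod_(j < k) _; set c := (2 * k).+1%:R.
  move: n0 ns; clearbody f E c n => n0 ns; field.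
  by rewrite n0 ns.
Qed.

(** The integral of cos^(2k) x cos (2 s x) over [0, pi/2] is at most that of
    cos^(2k) x.  By the recursion, the first is sin (pi s) / (2 s) divided by
    the Euler product and the second is pi / 2, up to the same factor [W]. *)
Lemma sin_le_Euler_prod {R : realType} {s : R} (k : nat) :
  0 < s < 1 ->
  sin (pi * s) <= pi * s * \prod_(j < k) (1 - s ^+ 2 / j.+1%:R ^+ 2).
Proof.
move=> /andP[s0 s1].
have s_neq0 : s != 0 by apply: lt0r_neq0.
have dlin (t x : R) : is_derive x 1 (fun y : R => t * y) t.
  apply: (is_derive_eq (is_deriveZ t (is_derive_id x 1))).
  by rewrite /GRing.scale /= mulr1.
have [|x||Fs [dFs Fs0 Fspi]] :=
    @cos_pow_antiderivative R s (fun x => (2 * s)^-1 * sin (2 * s * x)) k.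
- by rewrite (ltW s0).
- apply: (is_derive_eq (is_deriveZ (2 * s)^-1
    (is_derive1_comp (is_derive_sin _) (dlin (2 * s) x)))).
  by rewrite /GRing.scale /=; field.
- by rewrite mulr0 sin0 mulr0.
have [|x||F0 [dF0 F00 F0pi]] := @cos_pow_antiderivative R 0 (fun x => x) k.
- by rewrite lexx ltr01.
- by rewrite mulr0 mul0r cos0; exact: is_derive_id.
- by [].
have dH (x : R) : is_derive x 1 (F0 - Fs)
    (cos x ^+ (2 * k) * (1 - cos (2 * s * x))).
  apply: (is_derive_eq (is_deriveB (dF0 x) (dFs x))).
  by rewrite mulr0 mul0r cos0; ring.
have pi0 : 0 < pi :> R := pi_gt0 R.
(* The difference of the antiderivatives has a nonnegative derivative. *)
have FsF0 : Fs (pi / 2) <= F0 (pi / 2).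
  rewrite -subr_ge0.
  have -> : 0 = (F0 - Fs) 0 by rewrite !fctE F00 Fs0 subr0.
  have H := @ger0_derive1_ndecr R (F0 - Fs) 0 (pi / 2).
  apply: H; rewrite ?lexx //; last by apply: divr_ge0; lra.
  - move=> x _; rewrite derive1E derive_val exprM.
    by apply: mulr_ge0; [exact/exprn_ge0/sqr_ge0|rewrite subr_ge0 cos_le1].
  - exact: derivable_within_continuous.
set W := \prod_(j < k) ((2 * j).+1%:R / (2 * j).+2%:R) in Fspi F0pi.
have W0 : 0 < W by apply: prodr_gt0 => j _; apply: divr_gt0.
set E := \prod_(j < k) _ in Fspi *.
have E0 : 0 < E.
  apply: prodr_gt0 => j _; rewrite subr_gt0 ltr_pdivrMr ?exprn_gt0 ?ltr0n//.
  have : 1 <= j.+1%:R :> R by rewrite ler1n.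
  by nra.
have {}F0pi : F0 (pi / 2) = pi / 2 * W.
  rewrite -F0pi big1 ?mulr1// => j _.
  by rewrite expr0n mul0r subr0.
have {}Fspi : Fs (pi / 2) * E = (2 * s)^-1 * sin (pi * s) * W.
  by rewrite Fspi; congr (_ * sin _ * _); field.
have : (2 * s)^-1 * sin (pi * s) * W <= pi / 2 * W * E.
  by rewrite -Fspi ler_pM2r// -F0pi.
rewrite [leRHS]mulrAC ler_pM2r// mulrC ler_pdivrMr; last by lra.
by move=> h; apply: (le_trans h); rewrite le_eqVlt; apply/predU1P; left; field.
Qed.

(** * Schur weights for the Hilbert matrix *)

(** The Taylor coefficients s (s + 1) ... (s + m - 1) / m! of (1 - t)^(-s). *)
Definition ratio_weight {R : realType} (s : R) (m : nat) : R :=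
  \prod_(k < m) ((s + k%:R) / k.+1%:R).

Lemma ratio_weightS {R : realType} (s : R) (m : nat) :
  ratio_weight s m.+1 = ratio_weight s m * ((s + m%:R) / m.+1%:R).
Proof. by rewrite /ratio_weight big_ord_recr. Qed.

Lemma ratio_weight_gt0 {R : realType} {s : R} (m : nat) :
  0 < s -> 0 < ratio_weight s m.
Proof.
by move=> s0; apply: prodr_gt0 => k _; rewrite divr_gt0// ltr_wpDr.
Qed.

(** With u_n the coefficients of (1 - t)^(s-1), the full series is the beta
    integral of t^m (1 - t)^(s-1) over [0, 1], whose value is the right-hand
    side.  Its recursion in m holds for the partial sums up to the nonpositive
    error - N u_N / (m + N + 1), by telescoping in n. *)
Lemma ratio_weight_row_sum {R : realType} {s : R} (m N : nat) :
  0 < s < 1 ->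
  \sum_(n < N) ratio_weight (1 - s) n / (m + n + 1)%:R
    <= (ratio_weight s m * (s + m%:R))^-1.
Proof.
move=> /andP[s0 s1]; set u := ratio_weight (1 - s).
have u0 n : 0 < u n by apply: ratio_weight_gt0; lra.
have uS n : u n.+1 = u n * ((1 - s + n%:R) / n.+1%:R) by exact: ratio_weightS.
elim: m => [|m IHm].
  have -> : \sum_(n < N) u n / (0 + n + 1)%:R = (1 - u N) / s.
    elim: N => [|N IHN].
      by rewrite big_ord0 /u /ratio_weight big_ord0 subrr mul0r.
    rewrite big_ord_recr/= IHN uS add0n addn1 -natr1.
    have : N%:R + 1 != 0 :> R by rewrite natr1.
    move: (lt0r_neq0 s0) => sn Nn; field.
    by rewrite sn Nn.
  rewrite /ratio_weight big_ord0 mul1r addr0 ler_pdivrMr// mulVf ?lt0r_neq0//.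
  by rewrite lerBlDr lerDl ltW.
have rec : (s + m.+1%:R) * (\sum_(n < N) u n / (m.+1 + n + 1)%:R)
    = m.+1%:R * (\sum_(n < N) u n / (m + n + 1)%:R)
      - N%:R * u N / (m + N + 1)%:R.
  elim: N {IHm} => [|N IHN].
    by rewrite !big_ord0 !(mulr0, mul0r) subr0.
  rewrite !big_ord_recr/= !mulrDr IHN uS !addn1 !addSn !addnS -!natr1 !natrD.
  have N0 : 0 <= N%:R :> R by [].
  have m0 : 0 <= m%:R :> R by [].
  move: (u N) N0 m0 => v N0 m0.
  set A := \sum_(_ < _) _.
  field.
  by rewrite !lt0r_neq0; lra.
have sm : 0 < s + m%:R by rewrite ltr_wpDr.
have sm1 : 0 < s + m.+1%:R by rewrite ltr_wpDr.
have w0 : 0 < ratio_weight s m by exact: ratio_weight_gt0.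
rewrite ratio_weightS -(ler_pM2l sm1) rec.
have -> : (s + m.+1%:R) *
  (ratio_weight s m * ((s + m%:R) / m.+1%:R) * (s + m.+1%:R))^-1
  = m.+1%:R * (ratio_weight s m * (s + m%:R))^-1.
  have : m.+1%:R != 0 :> R by [].
  move: (lt0r_neq0 sm) (lt0r_neq0 sm1) (lt0r_neq0 w0).
  move: (ratio_weight s m) m.+1%:R m%:R => v y x ? ? ? ?; field.
  by apply/and4P.
apply: (le_trans (y := m.+1%:R * (\sum_(n < N) u n / (m + n + 1)%:R))).
  by rewrite lerBlDr lerDl divr_ge0// mulr_ge0// ltW.
by rewrite ler_pM2l.
Qed.

Lemma powR_split {R : realType} {x : R} (t : R) :
  0 < x -> x = x `^ (1 - t) * x `^ t.
Proof.
move=> x0; rewrite -powRD ?subrK ?powRr1 ?ltW//.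
by rewrite (lt0r_neq0 x0) implybT.
Qed.

Lemma weighted_AM_GM {R : realType} {t x y : R} :
  0 < t < 1 -> 0 <= x -> 0 <= y ->
  x `^ t * y `^ (1 - t) <= t * x + (1 - t) * y.
Proof.
move=> /andP[t0 t1] x0 y0.
have t1' : 0 < 1 - t by lra.
have tt1 : t^-1^-1 + (1 - t)^-1^-1 = 1 by rewrite !invrK; ring.
have := conjugate_powR (powR_ge0 x t) (powR_ge0 y (1 - t)) _ _ tt1.
rewrite !invr_gt0 !invrK -!powRrM !mulfV ?lt0r_neq0// !powRr1//.
by rewrite [x * t]mulrC [y * _]mulrC; apply.
Qed.

(** The p-th power of this number, for s = 1/q, is the factor that the Schur
    test puts on the m-th term of a sequence in l^p. *)
Definition hilbert_multiplier {R : realType} (s : R) (m : nat) : R :=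
  (ratio_weight s m * (s + m%:R) `^ (1 - s))^-1.

Lemma hilbert_multiplier_gt0 {R : realType} (s : R) (m : nat) :
  0 < s -> 0 < hilbert_multiplier s m.
Proof.
move=> s0; rewrite invr_gt0 mulr_gt0 ?ratio_weight_gt0// powR_gt0//.
by rewrite ltr_wpDr.
Qed.

(** One step amounts to (s + m)^s (s + m + 1)^(1-s) <= m + 1, where m + 1 is
    exactly the weighted arithmetic mean of s + m and s + m + 1. *)
Lemma hilbert_multiplier_le {R : realType} {s : R} {m n : nat} :
  0 < s < 1 -> (m <= n)%N ->
  hilbert_multiplier s m <= hilbert_multiplier s n.
Proof.
move=> s01; have /andP[s0 s1] := s01.
have step k : hilbert_multiplier s k <= hilbert_multiplier s k.+1.
  have sk : 0 < s + k%:R by rewrite ltr_wpDr.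
  have sk1 : 0 < s + k.+1%:R by rewrite ltr_wpDr.
  have w0 := ratio_weight_gt0 k s0.
  have w1 := ratio_weight_gt0 k.+1 s0.
  rewrite lef_pV2 ?posrE ?mulr_gt0 ?powR_gt0// ratio_weightS.
  rewrite -mulrA ler_pM2l//.
  have := weighted_AM_GM s01 (ltW sk) (ltW sk1).
  have -> : s * (s + k%:R) + (1 - s) * (s + k.+1%:R) = k.+1%:R.
    by rewrite -natr1; ring.
  move=> amgm.
  have -> : (s + k%:R) / k.+1%:R * (s + k.+1%:R) `^ (1 - s) =
      (s + k%:R) `^ (1 - s) *
      ((s + k%:R) `^ s * (s + k.+1%:R) `^ (1 - s) / k.+1%:R).
    by rewrite [X in X / _](powR_split s sk); ring.
  by rewrite ler_piMr ?powR_ge0// ler_pdivrMr ?mul1r.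
elim: n => [|n IHn]; first by rewrite leqn0 => /eqP ->.
by rewrite leq_eqVlt => /orP[/eqP ->//|/IHn /le_trans]; apply.
Qed.

(** Up to the powers of s + m and 1 - s + m, the inverse of the left-hand side is
    a partial Euler product for sin (pi s) / pi.  Replacing (1 - s + m)^s by
    (s + m)^s makes the powers combine to s + m; this goes in the right direction
    for s <= 1/2, which the symmetry between s and 1 - s allows to assume. *)
Lemma hilbert_multiplier_mul {R : realType} {s : R} (m : nat) :
  0 < s < 1 ->
  hilbert_multiplier s m * hilbert_multiplier (1 - s) m <= pi / sin (pi * s).
Proof.
wlog s2 : s / s <= 2^-1 => [wl s01|/andP[s0 s1]].
  have [|s2] := leP s 2^-1; first by move/wl; apply.
  have := wl (1 - s); rewrite mulrC subKr mulrBr mulr1.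
  by rewrite sinB sinpi cospi mul0r mulN1r sub0r opprK; apply; lra.
have pi0 := pi_gt0 R.
have sin0 : 0 < sin (pi * s).
  by apply: sin_gt0_pi; rewrite mulr_gt0//= gtr_pMr.
have s1' : 0 < 1 - s by lra.
have sm : 0 < s + m%:R by rewrite ltr_wpDr.
have sm1 : 0 < 1 - s + m%:R by rewrite ltr_wpDr.
rewrite -invfM subKr -[leRHS]invrK lef_pV2 ?posrE ?invr_gt0 ?divr_gt0//;
  last by rewrite !mulr_gt0 ?ratio_weight_gt0// powR_gt0.
rewrite invf_div ler_pdivrMr//.
apply: (le_trans (sin_le_Euler_prod m _)); first by rewrite s0.
rewrite -mulrA [leRHS]mulrC ler_pM2l//.
have -> : s * \prod_(j < m) (1 - s ^+ 2 / j.+1%:R ^+ 2) =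
    ratio_weight s m * ratio_weight (1 - s) m * (s + m%:R).
  elim: m {sm sm1} => [|m IHm].
    by rewrite /ratio_weight !big_ord0 !mul1r mulr1 addr0.
  rewrite big_ord_recr/= mulrA IHm !ratio_weightS -natr1.
  have : m%:R + 1 != 0 :> R by rewrite natr1.
  by move=> mn; field.
rewrite mulrACA -subr_ge0 -mulrBr.
apply: mulr_ge0; first by rewrite mulr_ge0// ltW// ratio_weight_gt0.
rewrite subr_ge0 [leLHS](powR_split s sm) ler_wpM2l ?powR_ge0//.
by rewrite ge0_ler_powR ?nnegrE ?(ltW sm) ?(ltW sm1) ?(ltW s0)//; lra.
Qed.

(** * The finite Hilbert inequality *)

Lemma hilbert_multiplier_row {R : realType} {p q : R} (m N : nat) :
  0 < p -> 0 < q -> p^-1 + q^-1 = 1 ->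
  ratio_weight q^-1 m `^ (- (p / q)) *
    (\sum_(n < N) ratio_weight p^-1 n / (m + n + 1)%:R)
  <= hilbert_multiplier q^-1 m `^ p.
Proof.
move=> p0 q0 pq.
have p1 : p^-1 = 1 - q^-1 by lra.
have pi0 : 0 < p^-1 by rewrite invr_gt0.
have qi0 : 0 < q^-1 by rewrite invr_gt0.
have q01 : 0 < q^-1 < 1 by lra.
have w0 := ratio_weight_gt0 m qi0.
have sm : 0 < q^-1 + m%:R by rewrite ltr_wpDr.
have epq : p / q = p - 1.
  by have -> : q^-1 = 1 - p^-1 by [lra]; rewrite mulrBr mulfV ?lt0r_neq0// mulr1.
have := ler_wpM2l (powR_ge0 (ratio_weight q^-1 m) (- (p / q)))
  (ratio_weight_row_sum m N q01).
rewrite -p1 => /le_trans; apply.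
rewrite /hilbert_multiplier -p1 epq.
move: (ratio_weight _ _) w0 (_ + _) sm => w w0 z z0.
have -> : (w * z `^ p^-1)^-1 = w `^ (-1) * z `^ (- p^-1).
  by rewrite invfM powR_inv1 ?(ltW w0)// powRN.
rewrite powRM ?powR_ge0// -!powRrM mulN1r mulNr mulVf ?lt0r_neq0//
  powR_inv1 ?(ltW z0)//.
rewrite invfM mulrA -[w^-1]powR_inv1 ?(ltW w0)// -powRD; last first.
  by rewrite (lt0r_neq0 w0) implybT.
by have -> : - (p - 1) + -1 = - p by ring.
Qed.

(** Schur test: Young's inequality is applied after dividing [a] and [b] by the
    largest multipliers on the block, which bounds the factors left on each
    a_m^p and b_n^q by 1. *)
Lemma hilbert_young {R : realType} {p q : R} (a b : nat -> R) (N : nat) :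
  0 < p -> 0 < q -> p^-1 + q^-1 = 1 ->
  (forall m, 0 <= a m) -> (forall m, 0 <= b m) ->
  \sum_(m < N) \sum_(n < N) a m * b n / (m + n + 1)%:R
  <= pi / sin (pi / p) *
     ((\sum_(m < N) a m `^ p) / p + (\sum_(n < N) b n `^ q) / q).
Proof.
move=> p0 q0 pq a0 b0.
have pi0 : 0 < p^-1 by rewrite invr_gt0.
have qi0 : 0 < q^-1 by rewrite invr_gt0.
have qp : q^-1 + p^-1 = 1 by rewrite addrC.
pose v := ratio_weight q^-1; pose u := ratio_weight p^-1.
pose X := hilbert_multiplier q^-1; pose Y := hilbert_multiplier p^-1.
have v0 m : 0 < v m by exact: ratio_weight_gt0.
have u0 m : 0 < u m by exact: ratio_weight_gt0.
have X0 m : 0 < X m by exact: hilbert_multiplier_gt0.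
have Y0 m : 0 < Y m by exact: hilbert_multiplier_gt0.
have XN m : (m <= N)%N -> X m <= X N by apply: hilbert_multiplier_le; lra.
have YN m : (m <= N)%N -> Y m <= Y N by apply: hilbert_multiplier_le; lra.
have XY : X N * Y N <= pi / sin (pi / p).
  have := hilbert_multiplier_mul (s := p^-1) N.
  have -> : 1 - p^-1 = q^-1 by lra.
  by rewrite mulrC; apply; lra.
pose S m n := (a m / X N) `^ p / p * v m `^ (- (p / q)) *
  (u n / (m + n + 1)%:R).
pose T n m := (b n / Y N) `^ q / q * u n `^ (- (q / p)) *
  (v m / (n + m + 1)%:R).
have young m n : a m * b n / (m + n + 1)%:R <= X N * Y N * (S m n + T n m).
  rewrite /S /T [(n + m)%N]addnC.
  have K0 : 0 <= (m + n + 1)%:R^-1 :> R by rewrite invr_ge0.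
  have aX : 0 <= a m / X N by rewrite divr_ge0// ltW.
  have bY : 0 <= b n / Y N by rewrite divr_ge0// ltW.
  have h x y e f : 0 <= x `^ e * y `^ f :> R by rewrite mulr_ge0 ?powR_ge0.
  have eA : (a m / X N * (v m `^ (- q^-1) * u n `^ p^-1)) `^ p =
      (a m / X N) `^ p * (v m `^ (- (p / q)) * u n).
    rewrite (powRM _ aX (h _ _ _ _)) (powRM _ (powR_ge0 _ _) (powR_ge0 _ _)).
    rewrite -!powRrM mulVf ?lt0r_neq0//.
    by rewrite powRr1 ?(ltW (u0 n))// mulNr [q^-1 * p]mulrC.
  have eB : (b n / Y N * (u n `^ (- p^-1) * v m `^ q^-1)) `^ q =
      (b n / Y N) `^ q * (u n `^ (- (q / p)) * v m).
    rewrite (powRM _ bY (h _ _ _ _)) (powRM _ (powR_ge0 _ _) (powR_ge0 _ _)).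
    rewrite -!powRrM mulVf ?lt0r_neq0//.
    by rewrite powRr1 ?(ltW (v0 m))// mulNr [p^-1 * q]mulrC.
  have := conjugate_powR (mulr_ge0 aX (h (v m) (u n) (- q^-1) p^-1))
    (mulr_ge0 bY (h (u n) (v m) (- p^-1) q^-1)) p0 q0 pq.
  rewrite eA eB => /(ler_wpM2l
    (mulr_ge0 (mulr_ge0 (ltW (X0 N)) (ltW (Y0 N))) K0)).
  set k := (_ + _)%:R^-1.
  have -> : X N * Y N * k * (a m / X N * (v m `^ (- q^-1) * u n `^ p^-1) *
      (b n / Y N * (u n `^ (- p^-1) * v m `^ q^-1))) = a m * b n * k.
    rewrite !powRN; field.
    by rewrite !lt0r_neq0 ?powR_gt0.
  move/le_trans; apply.
  move: (_ `^ p) (_ `^ q) (v m `^ _) (u n `^ _) => e f g h'.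
  rewrite le_eqVlt; apply/predU1P; left.
  by ring.
apply: (le_trans (y := \sum_(m < N) \sum_(n < N) X N * Y N * (S m n + T n m))).
  by apply: ler_sum => m _; apply: ler_sum => n _; exact: young.
apply: (le_trans (y := X N * Y N * ((\sum_(m < N) (a m `^ p) / p) +
   (\sum_(n < N) b n `^ q / q)))); last first.
  rewrite -!mulr_suml ler_wpM2r// addr_ge0// divr_ge0 ?(ltW p0) ?(ltW q0)//;
    by apply: sumr_ge0 => i _; rewrite powR_ge0.
under eq_bigr do rewrite -mulr_sumr.
rewrite -mulr_sumr ler_pM2l ?mulr_gt0//.
under eq_bigr do rewrite big_split/=.
rewrite big_split/= [X in _ + X]exchange_big/=.
(* The two halves agree up to exchanging p with q and the two sequences. *)
have half (f : nat -> R) (z : nat -> R) (r s : R) :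
    0 < r -> 0 < s -> r^-1 + s^-1 = 1 -> (forall m, 0 <= f m) ->
    (forall m, 0 < z m) -> (forall m, (m <= N)%N -> z m <= z N) ->
    z = hilbert_multiplier s^-1 ->
    \sum_(m < N) \sum_(n < N) (f m / z N) `^ r / r *
      ratio_weight s^-1 m `^ (- (r / s)) *
      (ratio_weight r^-1 n / (m + n + 1)%:R) <= \sum_(m < N) f m `^ r / r.
  move=> r0 s0 rs f0 z0 zN ez; apply: ler_sum => m _.
  rewrite -mulr_sumr -mulrA.
  apply: (le_trans (ler_wpM2l _ (hilbert_multiplier_row m N r0 s0 rs))).
    by rewrite divr_ge0 ?powR_ge0// ltW.
  rewrite mulrAC ler_wpM2r ?invr_ge0 ?(ltW r0)// -ez.
  rewrite -powRM ?divr_ge0 ?(ltW (z0 _))// ge0_ler_powR ?(ltW r0)//.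
  - by rewrite nnegrE mulr_ge0 ?divr_ge0 ?(ltW (z0 _)).
  - by rewrite nnegrE.
  - by rewrite mulrAC ler_pdivrMr// ler_wpM2l// zN// ltnW.
by apply: lerD; apply: half.
Qed.

(** The Young form is additive in the two pairs of sequences, so that a single
    rescaling by A^(1/p) and B^(1/q) yields the product form for the sum of both
    Hilbert forms; after it, the bracket of the Young form is at most
    1 / p + 1 / q = 1. *)
Lemma hilbert_pair {R : realType} {p q : R} {a b c d : nat -> R} {N : nat}
    {A B : R} :
  0 < p -> 0 < q -> p^-1 + q^-1 = 1 ->
  (forall m, 0 <= a m) -> (forall m, 0 <= b m) ->
  (forall m, 0 <= c m) -> (forall m, 0 <= d m) -> 0 < A -> 0 < B ->
  \sum_(m < N) (a m `^ p + c m `^ p) <= A ->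
  \sum_(m < N) (b m `^ q + d m `^ q) <= B ->
  \sum_(m < N) \sum_(n < N) (a m * b n + c m * d n) / (m + n + 1)%:R
  <= pi / sin (pi / p) * A `^ p^-1 * B `^ q^-1.
Proof.
move=> p0 q0 pq a0 b0 c0 d0 A0 B0 hA hB.
set x := A `^ p^-1; set y := B `^ q^-1; set C := pi / _.
have x0 : 0 < x by rewrite powR_gt0.
have y0 : 0 < y by rewrite powR_gt0.
have C0 : 0 <= C.
  have pi0 := pi_gt0 R.
  have ip : 0 < p^-1 by rewrite invr_gt0.
  have iq : 0 < q^-1 by rewrite invr_gt0.
  rewrite divr_ge0 ?(ltW pi0)// ltW// sin_gt0_pi// mulr_gt0//= gtr_pMr//; lra.
have xp (f : nat -> R) m : (forall i, 0 <= f i) ->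
    (f m / x) `^ p = f m `^ p / A.
  move=> f0; rewrite powRM ?invr_ge0 ?(ltW x0)//; congr (_ * _).
  by rewrite -powR_inv1 ?(ltW x0)// -!powRrM mulN1r mulrN mulVf ?lt0r_neq0//
    powR_inv1// ltW.
have yq (f : nat -> R) m : (forall i, 0 <= f i) ->
    (f m / y) `^ q = f m `^ q / B.
  move=> f0; rewrite powRM ?invr_ge0 ?(ltW y0)//; congr (_ * _).
  by rewrite -powR_inv1 ?(ltW y0)// -!powRrM mulN1r mulrN mulVf ?lt0r_neq0//
    powR_inv1// ltW.
have scaled (f g : nat -> R) : (forall i, 0 <= f i) -> (forall i, 0 <= g i) ->
    \sum_(m < N) \sum_(n < N) f m * g n / (m + n + 1)%:R <=
    C * x * y * ((\sum_(m < N) f m `^ p) / A / p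
               + (\sum_(n < N) g n `^ q) / B / q).
  move=> f0 g0.
  have := hilbert_young (fun m => f m / x) (fun n => g n / y) N p0 q0 pq.
  under [X in _ <= _ * (X / p + _)]eq_bigr => i _ do rewrite xp//.
  under [X in _ <= _ * (_ + X / q)]eq_bigr => i _ do rewrite yq//.
  rewrite -!mulr_suml.
  have -> : \sum_(m < N) \sum_(n < N) f m / x * (g n / y) / (m + n + 1)%:R =
      (\sum_(m < N) \sum_(n < N) f m * g n / (m + n + 1)%:R) / (x * y).
    rewrite mulr_suml; apply: eq_bigr => i _.
    rewrite mulr_suml; apply: eq_bigr => j _.
    by rewrite invfM; ring.
  move=> H.
  have {}H := H (fun m => divr_ge0 (f0 m) (ltW x0))
                (fun n => divr_ge0 (g0 n) (ltW y0)).
  rewrite ler_pdivrMr ?mulr_gt0// -/C in H.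
  by apply: (le_trans H); rewrite le_eqVlt; apply/predU1P; left; ring.
have -> : \sum_(m < N) \sum_(n < N) (a m * b n + c m * d n) / (m + n + 1)%:R =
    \sum_(m < N) \sum_(n < N) a m * b n / (m + n + 1)%:R +
    \sum_(m < N) \sum_(n < N) c m * d n / (m + n + 1)%:R.
  rewrite -big_split/=; apply: eq_bigr => i _.
  by rewrite -big_split/=; apply: eq_bigr => j _; rewrite mulrDl.
apply: (le_trans (lerD (scaled a b a0 b0) (scaled c d c0 d0))).
rewrite -mulrDr -[leRHS]mulr1
  ler_wpM2l ?(mulr_ge0 (mulr_ge0 C0 (ltW x0)) (ltW y0))//.
rewrite addrACA -!mulrDl -!big_split/= -pq.
by apply: lerD; rewrite -[leRHS]mul1r ler_pM2r ?invr_gt0// ler_pdivrMr// mul1r.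
Qed.

(** * From finite blocks to series *)

Lemma hilbert_shift_le {R : realType} {a b c d : nat -> R} (N : nat) :
  (forall m, 0 <= a m) -> (forall m, 0 <= b m) ->
  (forall m, 0 <= c m) -> (forall m, 0 <= d m) ->
  c 0%N * d 0%N + \sum_(1 <= m < N.+1) \sum_(1 <= n < N.+1)
    (a m * b n / (m + n)%:R + c m * d n / (m + n + 1)%:R)
  <= \sum_(m < N.+1) \sum_(n < N.+1)
       (a m.+1 * b n.+1 + c m * d n) / (m + n + 1)%:R.
Proof.
move=> a0 b0 c0 d0.
have splitD (f g : nat -> nat -> R) M :
    \sum_(m < M) \sum_(n < M) (f m n + g m n) =
    \sum_(m < M) \sum_(n < M) f m n + \sum_(m < M) \sum_(n < M) g m n.
  by rewrite -big_split/=; apply: eq_bigr => i _; rewrite -big_split.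
rewrite big_add1/= big_mkord.
under [X in _ + X <= _]eq_bigr => i _ do rewrite big_add1/= big_mkord.
under [leRHS]eq_bigr do under eq_bigr do rewrite mulrDl.
rewrite (splitD (fun m n => a m.+1 * b n.+1 / (m.+1 + n.+1)%:R)
  (fun m n => c m.+1 * d n.+1 / (m.+1 + n.+1 + 1)%:R)).
rewrite (splitD (fun m n => a m.+1 * b n.+1 / (m + n + 1)%:R)
  (fun m n => c m * d n / (m + n + 1)%:R)).
rewrite addrCA; apply: lerD.
- rewrite big_ord_recr/= -[leLHS]addr0; apply: lerD; last first.
    by apply: sumr_ge0 => n _; rewrite divr_ge0 ?mulr_ge0.
  apply: ler_sum => m _; rewrite big_ord_recr/= -[leLHS]addr0.
  apply: lerD; last by rewrite divr_ge0 ?mulr_ge0.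
  apply: ler_sum => n _; rewrite ler_wpM2l ?mulr_ge0//.
  rewrite lef_pV2 ?posrE ?ltr0n ?addn1//.
  by rewrite ler_nat addSn addnS ltnW.
- rewrite big_ord_recl/= big_ord_recl/= add0n divr1 -addrA lerD2l.
  rewrite -[leLHS]add0r; apply: lerD.
    by apply: sumr_ge0 => n _; rewrite divr_ge0 ?mulr_ge0.
  apply: ler_sum => m _; rewrite big_ord_recl/= -[leLHS]add0r.
  by apply: lerD; rewrite // divr_ge0 ?mulr_ge0.
Qed.

Lemma nneseries_le {R : realType} (u : nat -> \bar R) (k : nat) (r : \bar R) :
  (forall n, (0 <= u n)%E) ->
  (forall N, (\sum_(k <= n < N) u n <= r)%E) ->
  (\sum_(k <= n <oo) u n <= r)%E.
Proof.
move=> u0 ur; apply: lime_le; last by apply: nearW.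
by apply: is_cvg_nneseries => n _ _.
Qed.

Lemma double_nneseries_le {R : realType} (F : nat -> nat -> R) (k : nat) (r : R) :
  (forall m n, 0 <= F m n) ->
  (forall N, \sum_(k <= m < N.+1) \sum_(k <= n < N.+1) F m n <= r) ->
  (\sum_(k <= m <oo) \sum_(k <= n <oo) (F m n)%:E <= r%:E)%E.
Proof.
move=> F0 Fr.
have F0E m n : (0 <= (F m n)%:E)%E by rewrite lee_fin.
apply: nneseries_le => [m|M]; first by apply: nneseries_ge0.
rewrite -nneseries_sum_nat//.
apply: nneseries_le => [n|N]; first by apply: sume_ge0.
rewrite exchange_big/=.
apply: le_trans (_ : _ <= (\sum_(k <= m < (maxn M N).+1)
   \sum_(k <= n < (maxn M N).+1) F m n)%:E)%E _; last by rewrite lee_fin.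
rewrite -sumEFin; under [leRHS]eq_bigr do rewrite -sumEFin.
apply: (le_trans (y := (\sum_(k <= m < M)
   \sum_(k <= n < (maxn M N).+1) (F m n)%:E)%E)).
  apply: lee_sum => m _; apply: lee_sum_nneg_natr => //.
  by rewrite leqW// leq_maxr.
apply: lee_sum_nneg_natr => //; last by rewrite leqW// leq_maxl.
by move=> m _ _; exact: sume_ge0.
Qed.

(** The right-hand side of the main inequality has one such factor for [a], [c]
    and one for [b], [d]; the bound on partial sums is stated in the indexing of
    the finite inequality, where the first sequence is shifted by one. *)
Lemma joint_series_fin {R : realType} {f g : nat -> R} :
  (forall m, 0 <= f m) -> (forall m, 0 <= g m) ->
  (0 < \sum_(1 <= m <oo) (f m)%:E < +oo)%E ->
  (\sum_(0 <= m <oo) (g m)%:E < +oo)%E ->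
  exists A : R, [/\ 0 < A,
    ((g 0%N)%:E + \sum_(1 <= m <oo) (f m + g m)%:E = A%:E)%E
    & forall N, \sum_(m < N) (f m.+1 + g m) <= A].
Proof.
move=> f0 g0 /andP[fpos ffin] gfin.
have f0E m : (0 <= (f m)%:E)%E by rewrite lee_fin.
have g0E m : (0 <= (g m)%:E)%E by rewrite lee_fin.
set S := (_ + _)%E.
have eS : S = (\sum_(1 <= m <oo) (f m)%:E + \sum_(0 <= m <oo) (g m)%:E)%E.
  rewrite /S; under eq_eseriesr do rewrite EFinD.
  rewrite nneseriesD// addeCA; congr (_ + _)%E.
  by rewrite [RHS](nneseries_split 0 1)// big_nat1.
have S0 : (0 < S)%E.
  by rewrite eS (lt_le_trans fpos)// leeDl// nneseries_ge0.
have Sfin : S \is a fin_num.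
  by rewrite ge0_fin_numE ?ltW// eS lte_add_pinfty.
exists (fine S); split; first by rewrite fine_gt0// S0 -ge0_fin_numE// ltW.
  by rewrite fineK.
move=> N; rewrite -lee_fin fineK//.
apply: (le_trans (y := (g 0%N)%:E + \sum_(1 <= m < N.+1) (f m + g m)%:E)%E);
  last first.
  rewrite /S leeD2l//; apply: nneseries_lim_ge => m _ _.
  by rewrite lee_fin addr_ge0.
rewrite sumEFin -EFinD lee_fin big_add1/= big_mkord !big_split/= addrCA lerD2l.
by rewrite -(big_ord_recl N (fun i => g i)) big_ord_recr/= lerDl//.
Qed.

Local Open Scope ereal_scope.

Theorem mainTheorem1 (R : realType) (p q : R) (a b c d : nat -> R)
  (hp : (1 < p)%R) (hq : q = (p / (p - 1))%R)
  (ha : forall m : nat, (0 <= a m)%R) (hb : forall m : nat, (0 <= b m)%R)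
  (hc : forall m : nat, (0 <= c m)%R) (hd : forall m : nat, (0 <= d m)%R)
  (hap : 0 < \sum_(1 <= m <oo) (a m `^ p)%:E < +oo)
  (hbq : 0 < \sum_(1 <= m <oo) (b m `^ q)%:E < +oo)
  (hcp : 0 < \sum_(0 <= m <oo) (c m `^ p)%:E < +oo)
  (hdq : 0 < \sum_(0 <= m <oo) (d m `^ q)%:E < +oo) :
  (c 0%N * d 0%N)%:E
  + \sum_(1 <= m <oo) \sum_(1 <= n <oo)
      (a m * b n / (m + n)%:R + c m * d n / (m + n + 1)%:R)%:E
  <= (pi / sin (pi / p))%:E
     * ((c 0%N `^ p)%:E + \sum_(1 <= m <oo) (a m `^ p + c m `^ p)%:E) `^ p^-1
     * ((d 0%N `^ q)%:E + \sum_(1 <= m <oo) (b m `^ q + d m `^ q)%:E) `^ q^-1.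
Proof.
have p0 : (0 < p)%R by lra.
have p1 : (0 < p - 1)%R by lra.
have q0 : (0 < q)%R by rewrite hq divr_gt0.
have pq : (p^-1 + q^-1 = 1)%R.
  by rewrite hq; field; rewrite !lt0r_neq0.
have /andP[_ cfin] := hcp; have /andP[_ dfin] := hdq.
have [A [A0 -> hA]] := joint_series_fin (fun m => powR_ge0 (a m) p)
  (fun m => powR_ge0 (c m) p) hap cfin.
have [B [B0 -> hB]] := joint_series_fin (fun m => powR_ge0 (b m) q)
  (fun m => powR_ge0 (d m) q) hbq dfin.
rewrite !poweR_EFin -!EFinM addeC -leeBrDr// -EFinB.
apply: double_nneseries_le => [m n|N].
  by rewrite addr_ge0// divr_ge0 ?mulr_ge0.
rewrite lerBrDr addrC.
apply: (le_trans (hilbert_shift_le N ha hb hc hd)).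
exact: (hilbert_pair (a := fun m => a m.+1) (b := fun m => b m.+1)
  p0 q0 pq (fun m => ha m.+1) (fun m => hb m.+1) hc hd A0 B0 (hA N.+1) (hB N.+1)).
Qed.
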